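(* Let $H$ be an infinite dimensional real or complex Hilbert space and let $\phi:P_\infty(H)\to P_\infty(H)$ be a surjective map such that $\angle(\phi(P),\phi(Q))=\angle(P,Q)$ for all $P,Q\in P_\infty(H)$. Then there exists a unitary or antiunitary operator $U$ on $H$ such that $\phi(P)=UPU^*$ for all $P\in P_\infty(H)$.
   Context: A projection means a self-adjoint idempotent bounded operator on $H$; $P_\infty(H)$ is the set of all projections of infinite rank. For projections $P,Q,P',Q'$, ''$\angle(P,Q)=\angle(P',Q')$'' means by definition that the positive operators $QPQ$ and $Q'P'Q'$ are unitarily equivalent (orthogonally equivalent in the real case). In the real case ''unitary or antiunitary'' means orthogonal. *)

(* Defs.v *)
From mathcomp Require Import all_boot all_algebra.
From mathcomp Require Import reals.
From mathcomp Require Import complex.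
Set Implicit Arguments. Unset Strict Implicit. Unset Printing Implicit Defensive.
Import GRing.Theory Num.Theory.
Local Open Scope ring_scope.

Section HilbertDefs.
Variables (K : numFieldType) (cj : K -> K) (V : lmodType K) (ip : V -> V -> K).

(* ip is an inner product (linear in the 1st argument, cj-symmetric,
   positive definite); cj = id (real case) or complex conjugation. *)
Definition is_inner_product : Prop :=
  [/\ forall (a : K) (x y z : V), ip (a *: x + y) z = a * ip x z + ip y z,
      forall x y, ip y x = cj (ip x y),
      forall x, 0 <= ip x x
    & forall x, ip x x = 0 -> x = 0].

Definition ip_complete : Prop :=
  forall u : nat -> V,
    (forall e : K, 0 < e -> exists N, forall m n, (N <= m)%N -> (N <= n)%N ->
        `|ip (u m - u n) (u m - u n)| < e) ->
    exists l : V, forall e : K, 0 < e -> exists N, forall n, (N <= n)%N ->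
        `|ip (u n - l) (u n - l)| < e.

Definition is_hilbert : Prop := is_inner_product /\ ip_complete.

Definition lin_indep (n : nat) (e : 'I_n -> V) : Prop :=
  forall c : 'I_n -> K, \sum_(i < n) c i *: e i = 0 -> forall i, c i = 0.

Definition infinite_dimensional (S : V -> Prop) : Prop :=
  forall n : nat, exists e : 'I_n -> V, (forall i, S (e i)) /\ lin_indep e.

Definition semilinear (s : K -> K) (f : V -> V) : Prop :=
  forall (a : K) (x y : V), f (a *: x + y) = s a *: f x + f y.

Definition bounded_op (T : V -> V) : Prop :=
  exists M : K, forall x, `|ip (T x) (T x)| <= M * `|ip x x|.

Definition is_projection (P : V -> V) : Prop :=
  [/\ semilinear id P, bounded_op P, forall x, P (P x) = P x
    & forall x y, ip (P x) y = ip x (P y)].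

Definition proj_inf (P : V -> V) : Prop :=
  is_projection P /\ infinite_dimensional (fun y => exists x, P x = y).

Definition isometric_onto (s : K -> K) (U : V -> V) : Prop :=
  [/\ semilinear s U, forall y, exists x, U x = y
    & forall x y, ip (U x) (U y) = s (ip x y)].

Definition unitary (U : V -> V) : Prop := isometric_onto id U.
Definition antiunitary (U : V -> V) : Prop := isometric_onto cj U.

(* angle(P,Q) = angle(P',Q') : QPQ and Q'P'Q' are unitarily equivalent,
   i.e. Q'P'Q' = W (QPQ) W^* for a unitary W (W^* = W^{-1}) *)
Definition same_angle (P Q P' Q' : V -> V) : Prop :=
  exists W Wstar : V -> V, [/\ unitary W, cancel W Wstar, cancel Wstar W
    & forall x, Q' (P' (Q' x)) = W (Q (P (Q (Wstar x))))].

Definition theorem4_body : Prop :=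
  is_hilbert -> infinite_dimensional (fun _ => True) ->
  forall phi : (V -> V) -> (V -> V),
    (forall P, proj_inf P -> proj_inf (phi P)) ->
    (forall Q, proj_inf Q -> exists P, proj_inf P /\ phi P = Q) ->
    (forall P Q, proj_inf P -> proj_inf Q -> same_angle P Q (phi P) (phi Q)) ->
    exists U Ustar : V -> V,
      [/\ unitary U \/ antiunitary U, cancel U Ustar, cancel Ustar U
        & forall P, proj_inf P -> forall x, phi P x = U (P (Ustar x))].

End HilbertDefs.

(* Main.v *)
(** Call a projection [bi_inf] when its range and its kernel are infinite
    dimensional.  [phi] preserves orthogonality in both directions, and on
    [bi_inf] projections [P <= Q] means orthogonality to the complement of [Q],
    so [phi] is an order automorphism there and commutes with complements.

    If [A] is [bi_inf] and [A x = 0], the operator [Q A^c Q] with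
    [Q = A + [x]] is the rank one projection [[x]]; preservation of its angle
    gives [phi (A + [x]) = phi A + [v]] for some [v] with the norm of [x].  The
    line of [v] does not depend on [A]: for orthogonal [A], [A'] both choices
    span the range of the rank one compression attached to [A + [x]] and
    [A' + [x]], and any two [A], [A'] contain orthogonal infinite dimensional
    [D], [D'].  Compressing [A' + [y]] to [A + [x]] shows that the induced map
    of lines preserves transition probabilities, so Wigner's theorem provides
    [U], which implements [phi] on [bi_inf] projections.

    If [P] has finite corank, every [bi_inf] projection below [U P U^*] commutes
    with [phi P], which forces [phi P] to be scalar on the range of [U P U^*];
    this gives [U P U^* <= phi P], and the reverse inequality is symmetric. *)
Require Import Defs.
From mathcomp Require Import all_boot all_order all_algebra.
From mathcomp Require Import boolp classical_sets reals complex ring.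
Set Implicit Arguments. Unset Strict Implicit. Unset Printing Implicit Defensive.
Import Order.TTheory GRing.Theory Num.Theory.
Local Open Scope ring_scope.

(** * Inner products, real and complex scalars treated together *)

Section InnerProduct.
Variables (K : numFieldType) (cj : {rmorphism K -> K}).
Hypothesis cjK : involutive cj.
Hypothesis mul_cj : forall z : K, z * cj z = `|z| ^+ 2.
Variables (V : lmodType K) (ip : V -> V -> K).
Hypothesis ipP : is_inner_product cj ip.

Implicit Types (x y z u v : V) (a b c e k : K).

Lemma ip_lin a x y z : ip (a *: x + y) z = a * ip x z + ip y z.
Proof. by case: ipP. Qed.

Lemma ipC x y : ip y x = cj (ip x y).
Proof. by case: ipP. Qed.

Lemma ip_ge0 x : 0 <= ip x x.
Proof. by case: ipP. Qed.

Lemma ip_eq0 x : ip x x = 0 -> x = 0.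
Proof. by case: ipP => _ _ _; apply. Qed.

Lemma ipDl x y z : ip (x + y) z = ip x z + ip y z.
Proof. by have := ip_lin 1 x y z; rewrite scale1r mul1r. Qed.

Lemma ip0l z : ip 0 z = 0.
Proof. by apply: (addrI (ip 0 z)); rewrite -ipDl !addr0. Qed.

Lemma ipZl a x z : ip (a *: x) z = a * ip x z.
Proof. by have := ip_lin a x 0 z; rewrite ip0l !addr0. Qed.

Lemma ipNl x z : ip (- x) z = - ip x z.
Proof. by rewrite -scaleN1r ipZl mulN1r. Qed.

Lemma ipDr x y z : ip z (x + y) = ip z x + ip z y.
Proof. by rewrite ipC ipDl rmorphD -!ipC. Qed.

Lemma ip0r z : ip z 0 = 0.
Proof. by rewrite ipC ip0l rmorph0. Qed.

Lemma ipZr a x z : ip z (a *: x) = cj a * ip z x.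
Proof. by rewrite ipC ipZl rmorphM -ipC. Qed.

Lemma ipNr x z : ip z (- x) = - ip z x.
Proof. by rewrite ipC ipNl rmorphN -ipC. Qed.

Definition ipE := (ipDl, ipZl, ipNl, ip0l, ipDr, ipZr, ipNr, ip0r).

Lemma ip_suml (I : finType) (f : I -> V) z :
  ip (\sum_i f i) z = \sum_i ip (f i) z.
Proof. by apply: (big_morph (ip^~ z)) => [x y|]; rewrite ?ipDl ?ip0l. Qed.

Lemma ip_ext x y : (forall z, ip x z = ip y z) -> x = y.
Proof.
move=> e; apply/eqP; rewrite -subr_eq0; apply/eqP/ip_eq0.
by rewrite ipDl ipNl e subrr.
Qed.

Lemma ip_gt0 x : x <> 0 -> 0 < ip x x.
Proof.
by move=> x0; rewrite lt_def ip_ge0 andbT; apply/eqP => /ip_eq0.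
Qed.

Lemma ip_neq0 x : x <> 0 -> ip x x != 0.
Proof. by move/ip_gt0; rewrite lt0r => /andP[]. Qed.

Lemma cj_ipxx x : cj (ip x x) = ip x x.
Proof. by rewrite -ipC. Qed.

Lemma ip_perpC x y : ip x y = 0 -> ip y x = 0.
Proof. by move=> h; rewrite ipC h rmorph0. Qed.

Lemma norm_ip x : `|ip x x| = ip x x.
Proof. exact/normr_idP/ip_ge0. Qed.

Lemma norm_cj a : `|cj a| = `|a|.
Proof.
by apply/eqP; rewrite -(eqrXn2 (n := 2)) // -!mul_cj cjK mulrC.
Qed.

Lemma norm_ipC x y : `|ip y x| = `|ip x y|.
Proof. by rewrite ipC norm_cj. Qed.

(** The orthogonal projection onto the span of [x]; for [x = 0] it is the zero map. *)
Definition line x u := (ip u x / ip x x) *: x.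

Lemma line_perp x u : ip u x = 0 -> line x u = 0.
Proof. by rewrite /line => ->; rewrite mul0r scale0r. Qed.

Lemma line0 u : line 0 u = 0.
Proof. by rewrite /line scaler0. Qed.

Lemma line_id x : line x x = x.
Proof.
have [->|/eqP x0] := eqVneq x 0; first by rewrite line0.
by rewrite /line divff ?scale1r ?ip_neq0.
Qed.

Lemma ip_line x u : x <> 0 -> ip (line x u) x = ip u x.
Proof. by move=> x0; rewrite ipZl divfK ?ip_neq0. Qed.

Lemma lineC x u v : ip (line x u) v = ip u (line x v).
Proof.
rewrite !(ipZl, ipZr) rmorphM fmorphV /= cj_ipxx -(ipC v x).
by rewrite mulrAC [RHS]mulrAC; congr (_ / _); rewrite mulrC.
Qed.

Lemma pythagoras x u : x <> 0 ->
  ip (u - line x u) (u - line x u) = ip u u - `|ip u x| ^+ 2 / ip x x.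
Proof.
move=> x0; have h : ip (u - line x u) x = 0.
  by rewrite ipDl ipNl ip_line // subrr.
rewrite ipDr ipNr {3}/line ipZr h mulr0 subr0 ipDl ipNl /line ipZl.
by rewrite -mul_cj -(ipC u x) mulrAC.
Qed.

Lemma cauchy_schwarz x y : `|ip x y| ^+ 2 <= ip x x * ip y y.
Proof.
have [->|/eqP y0] := eqVneq y 0; first by rewrite !ip0r normr0 expr0n mulr0.
have := ip_ge0 (x - line y x); rewrite pythagoras // subr_ge0.
by rewrite ler_pdivrMr ?ip_gt0.
Qed.

Lemma cauchy_schwarz_eq x y : y <> 0 ->
  `|ip x y| ^+ 2 = ip x x * ip y y -> x = line y x.
Proof.
move=> y0 e; apply/eqP; rewrite -subr_eq0; apply/eqP/ip_eq0.
by rewrite pythagoras // e mulfK ?subrr ?ip_neq0.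
Qed.


(** Symmetry gives linearity by testing against every [z]; the bound [1] comes from
    [|x|^2 - |P x|^2 = |x - P x|^2]. *)
Lemma mk_projection (P : V -> V) :
  (forall x y, ip (P x) y = ip x (P y)) -> (forall x, P (P x) = P x) ->
  is_projection ip P.
Proof.
move=> PC PK; split => //.
  move=> a x y; apply: ip_ext => z.
  by rewrite PC !ipE !PC.
exists 1 => x; rewrite mul1r !norm_ip -subr_ge0.
have -> : ip x x - ip (P x) (P x) = ip (x - P x) (x - P x).
  by rewrite !ipE -!PC PK; ring.
exact: ip_ge0.
Qed.

(** * Projections *)

Definition compl (P : V -> V) x := x - P x.
Definition padd (P Q : V -> V) x := P x + Q x.
Definition orth (P Q : V -> V) := forall x, P (Q x) = 0.
Definition le_proj (P Q : V -> V) := forall x, Q (P x) = P x.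

Section Projection.
Variable P : V -> V.
Hypothesis projP : is_projection ip P.

Lemma projK x : P (P x) = P x.
Proof. by case: projP. Qed.

Lemma projC x y : ip (P x) y = ip x (P y).
Proof. by case: projP. Qed.

Lemma projZ a x : P (a *: x) = a *: P x.
Proof. by apply: ip_ext => z; rewrite projC !ipZl projC. Qed.

Lemma projD x y : P (x + y) = P x + P y.
Proof. by apply: ip_ext => z; rewrite projC !ipDl !projC. Qed.

Lemma projN x : P (- x) = - P x.
Proof. by apply: ip_ext => z; rewrite projC !ipNl !projC. Qed.

Lemma proj0 : P 0 = 0.
Proof. by apply: ip_ext => z; rewrite projC !ip0l. Qed.

Lemma proj_compl : is_projection ip (compl P).
Proof.
apply: mk_projection => [x y|x]; rewrite /compl; first by rewrite !ipE projC.
by rewrite projD projN projK subrr subr0.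
Qed.

Lemma complK : compl (compl P) = P.
Proof. by apply: funext => x; rewrite /compl subKr. Qed.

(** The hypothesis says [|P x| = |x|], so by Pythagoras the component [x - P x] has norm zero. *)
Lemma proj_fix x : ip (P x) x = ip x x -> P x = x.
Proof.
move=> h; apply/esym/eqP; rewrite -subr_eq0; apply/eqP/ip_eq0.
have h' : ip x (P x) = ip x x by rewrite -projC.
by rewrite !ipE (projC x (P x)) projK h h'; ring.
Qed.

Lemma proj_perp x : ip (P x) x = 0 -> P x = 0.
Proof. by move=> h; apply: ip_eq0; rewrite projC projK -projC. Qed.

End Projection.

Lemma proj_line x : is_projection ip (line x).
Proof.
apply: mk_projection => [u v|u]; first exact: lineC.
have [->|/eqP x0] := eqVneq x 0; first by rewrite !line0.
by rewrite {1}/line ip_line.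
Qed.

Lemma orthC P Q : is_projection ip P -> is_projection ip Q ->
  orth P Q -> orth Q P.
Proof.
move=> pP pQ o x; apply: ip_ext => z.
by rewrite (projC pQ) (projC pP) o ip0r ip0l.
Qed.

Lemma proj_padd P Q : is_projection ip P -> is_projection ip Q ->
  orth P Q -> is_projection ip (padd P Q).
Proof.
move=> pP pQ o; have o' := orthC pP pQ o.
apply: mk_projection => [x y|x]; rewrite /padd.
  by rewrite ipDl ipDr (projC pP) (projC pQ).
by rewrite (projD pP) (projD pQ) o o' (projK pP) (projK pQ) addr0 add0r.
Qed.

Lemma le_projC P Q : is_projection ip P -> is_projection ip Q ->
  le_proj P Q -> forall x, P (Q x) = P x.
Proof.
move=> pP pQ l x; apply: ip_ext => z.
by rewrite (projC pP) (projC pQ) l (projC pP).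
Qed.

Lemma le_proj_anti P Q : is_projection ip P -> is_projection ip Q ->
  le_proj P Q -> le_proj Q P -> P = Q.
Proof. by move=> pP pQ l m; apply: funext => x; rewrite -(le_projC pP pQ l) m. Qed.

Lemma le_orth_compl P Q : le_proj P Q <-> orth (compl Q) P.
Proof.
split => h x; have := h x; rewrite /compl => e.
  by rewrite e subrr.
by apply/esym/eqP; rewrite -subr_eq0 e.
Qed.

Lemma orth_line P x : is_projection ip P -> P x = 0 -> orth P (line x).
Proof. by move=> pP h u; rewrite /line (projZ pP) h scaler0. Qed.

(** * Nearest points and the existence of projections *)

Hypothesis inf_exists : forall S : K -> Prop,
  (exists a, S a) -> (forall a, S a -> 0 <= a) ->
  exists g, (forall a, S a -> g <= a) /\
    forall e : K, 0 < e -> exists2 a, S a & a < g + e.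
Hypothesis invn_small : forall e : K, 0 < e -> exists n, n.+1%:R^-1 < e.
Hypothesis ip_cpl : ip_complete ip.

Lemma small_eq0 a : 0 <= a -> (forall e : K, 0 < e -> a < e) -> a = 0.
Proof.
move=> a0 h; apply/eqP/negPn/negP => na.
by have := h a; rewrite lt_def na a0 ltxx => /(_ isT).
Qed.

Lemma norm_small_eq0 a b : 0 <= b ->
  (forall e : K, 0 < e -> `|a| ^+ 2 <= b * e) -> a = 0.
Proof.
move=> b0 h; apply/eqP; rewrite -normr_eq0 -sqrf_eq0; apply/eqP/small_eq0.
  exact: exprn_ge0.
move=> e e0; have b1 : 0 < b + 1 by rewrite ltr_wpDl.
apply: le_lt_trans (h (e / (b + 1)) _) _; first exact: divr_gt0.
by rewrite mulrA ltr_pdivrMr // mulrC ltr_pM2l // ltrDl.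
Qed.

Section Nearest.
Variables (S : V -> Prop) (x : V).
Let M y := forall s, S s -> ip y s = 0.

(** The projection theorem for the orthogonal complement [M] of [S]: a minimizing sequence [y] is
    Cauchy, its limit stays in [M] by Cauchy-Schwarz, and the approximate orthogonality of [x - y n]
    to [M] passes to the limit. *)
Lemma nearest_point : exists2 l, M l & forall m, M m -> ip (x - l) m = 0.
Proof.
have M0 : M 0 by move=> s _; rewrite ip0l.
have MD y y' : M y -> M y' -> M (y + y').
  by move=> h h' s Ss; rewrite ipDl h ?h' ?addr0.
have MZ a y : M y -> M (a *: y) by move=> h s Ss; rewrite ipZl h ?mulr0.
pose D a := exists2 y, M y & a = ip (x - y) (x - y).
have [|a [y _ ->]|d [dle dinf]] := @inf_exists D.
- by exists (ip (x - 0) (x - 0)), 0.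
- exact: ip_ge0.
have dle' y : M y -> d <= ip (x - y) (x - y) by move=> h; apply: dle; exists y.
have /choice[y yP] (n : nat) :
    exists y, M y /\ ip (x - y) (x - y) < d + n.+1%:R^-1.
  have [|a [y My ->] h] := dinf n.+1%:R^-1; first by rewrite invr_gt0.
  by exists y.
(* Moving [y n] by the projection of [x - y n] onto [m] lowers the squared distance by
   [|ip (x - y n) m|^2 / ip m m], which cannot exceed the slack [1/(n+1)]. *)
have perp n m : M m -> `|ip (x - y n) m| ^+ 2 <= n.+1%:R^-1 * ip m m.
  move=> Mm; have [->|/eqP m0] := eqVneq m 0.
    by rewrite !ip0r normr0 expr0n mulr0.
  have [My h] := yP n.
  have := dle' (y n + line m (x - y n)) (MD _ _ My (MZ _ _ Mm)).
  rewrite opprD addrA pythagoras // lerBrDr -lerBrDl ler_pdivrMr ?ip_gt0 //.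
  move/le_trans; apply; rewrite ler_wpM2r ?ip_ge0 // lerBlDl; exact: ltW.
(* Parallelogram law: the midpoint [c] of [y m] and [y n] lies in [M], so its squared distance from
   [x] is at least [d]. *)
have cauchy m n : ip (y m - y n) (y m - y n) <= 2 * (m.+1%:R^-1 + n.+1%:R^-1).
  have [Mm hm] := yP m; have [Mn hn] := yP n.
  pose c := 2^-1 *: (y m + y n).
  have hc : d <= ip (x - c) (x - c) by apply: dle'; apply: MZ; apply: MD.
  have two0 : (2 : K) != 0 by rewrite pnatr_eq0.
  have -> : ip (y m - y n) (y m - y n) = 2 * (ip (x - y m) (x - y m)
      + ip (x - y n) (x - y n) - 2 * ip (x - c) (x - c)).
    rewrite /c !ipE rmorphV ?unitfE // rmorph_nat.
    by field.
  rewrite ler_pM2l ?ltr0n // lerBlDr.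
  apply: le_trans (lerD (ltW hm) (ltW hn)) _.
  rewrite addrACA addrC lerD2l -mulr2n -[X in X <= _]mulr_natl.
  by rewrite ler_pM2l ?ltr0n.
have small (e : K) : 0 < e -> exists N, forall n, (N <= n)%N -> n.+1%:R^-1 < e.
  move=> e0; have [N hN] := invn_small e0; exists N => n Nn; apply: le_lt_trans hN.
  by rewrite lef_pV2 ?posrE ?ltr0n // ler_nat ltnS.
have [|l lP] := ip_cpl (u := y).
  move=> e e0; have [|N hN] := small (e / 4); first exact: divr_gt0.
  exists N => m n Nm Nn; rewrite norm_ip; apply: le_lt_trans (cauchy m n) _.
  have -> : e = 2 * (e / 4 + e / 4) by field.
  by rewrite ltr_pM2l ?ltr0n // ltrD ?hN.
have lim (e : K) : 0 < e -> exists n, n.+1%:R^-1 < e /\ ip (y n - l) (y n - l) < e.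
  move=> e0; have [N hN] := small e e0; have [N' hN'] := lP e e0.
  exists (maxn N N'); split; first by apply/hN/leq_maxl.
  by have := hN' _ (leq_maxr N N'); rewrite norm_ip.
exists l => [s Ss|m Mm].
  apply: (norm_small_eq0 (ip_ge0 s)) => e /lim[n [_ h]].
  have -> : ip l s = - ip (y n - l) s.
    by rewrite !ipE (proj1 (yP n) s Ss) sub0r opprK.
  rewrite normrN; apply: le_trans (cauchy_schwarz _ _) _.
  by rewrite mulrC ler_wpM2l ?ip_ge0 ?ltW.
(* The factor [4] comes from [(|p| + |q|)^2 <= 2|p|^2 + 2|q|^2], where each square is at most
   [ip m m * e]. *)
apply: (norm_small_eq0 (b := 4 * ip m m)).
  by rewrite mulr_ge0 ?ip_ge0.
move=> e e0; have [n [h1 h2]] := lim e e0.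
have -> : ip (x - l) m = ip (x - y n) m + ip (y n - l) m by rewrite !ipE; ring.
set p := ip (x - y n) m; set q := ip (y n - l) m.
have hp : `|p| ^+ 2 <= ip m m * e.
  apply: le_trans (perp n m Mm) _; rewrite mulrC.
  by rewrite ler_wpM2l ?ip_ge0 ?ltW.
have hq : `|q| ^+ 2 <= ip m m * e.
  apply: le_trans (cauchy_schwarz _ _) _; rewrite mulrC.
  by rewrite ler_wpM2l ?ip_ge0 ?ltW.
have -> : 4 * ip m m * e = 2 * (ip m m * e) + 2 * (ip m m * e) by ring.
apply: (@le_trans _ _ (2 * `|p| ^+ 2 + 2 * `|q| ^+ 2)); last first.
  by apply: lerD; rewrite ler_pM2l ?ltr0n.
apply: (@le_trans _ _ ((`|p| + `|q|) ^+ 2)).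
  by rewrite lerXn2r ?nnegrE ?addr_ge0 // ler_normD.
rewrite -subr_ge0.
have -> : 2 * `|p| ^+ 2 + 2 * `|q| ^+ 2 - (`|p| + `|q|) ^+ 2
  = (`|p| - `|q|) ^+ 2 by ring.
by rewrite real_exprn_even_ge0 // rpredB ?normr_real.
Qed.

End Nearest.

(** The two conditions describe the projection onto the closed span of [S]. It is [compl f], where
    [f] is the nearest point map onto the orthogonal complement of [S]. *)
Lemma exists_proj (S : V -> Prop) : exists P, [/\ is_projection ip P,
  forall s, S s -> P s = s &
  forall y, (forall s, S s -> ip y s = 0) -> P y = 0].
Proof.
have /choice[f fP] x : exists l, (forall s, S s -> ip l s = 0) /\
    forall m, (forall s, S s -> ip m s = 0) -> ip (x - l) m = 0.
  by have [l] := nearest_point S x; exists l.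
have fS x s : S s -> ip (f x) s = 0 by apply: (proj1 (fP x)).
have fp x m : (forall s, S s -> ip m s = 0) -> ip (x - f x) m = 0.
  by apply: (proj2 (fP x)).
have fy x y : ip (x - f x) (f y) = 0 by apply: fp => s; exact: fS.
exists (compl f); rewrite /compl; split.
- apply: mk_projection => [x y|x].
    have := fy x y; have := ip_perpC (fy y x); rewrite !ipE.
    by move=> /eqP; rewrite subr_eq0 => /eqP -> /eqP; rewrite subr_eq0 => /eqP ->.
  suff -> : f (x - f x) = 0 by rewrite subr0.
  set w := f _; apply: ip_eq0.
  have := fy (x - f x) (x - f x); rewrite -/w ipDl ipNl fy sub0r => /eqP.
  by rewrite oppr_eq0 => /eqP.
- move=> s Ss; suff -> : f s = 0 by rewrite subr0.
  apply: ip_eq0; have := fy s s; rewrite ipDl ipNl.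
  by rewrite (ip_perpC (fS s s Ss)) sub0r => /eqP; rewrite oppr_eq0 => /eqP.
- move=> y hy; apply: ip_eq0; apply: fp => s Ss.
  by rewrite ipDl ipNl hy // fS // subr0.
Qed.

(** * Orthogonal sequences and infinite rank *)

Definition subspace (S : V -> Prop) :=
  S 0 /\ forall a x y, S x -> S y -> S (a *: x + y).

Lemma subspace_sum (S : V -> Prop) (I : finType) (c : I -> K) (f : I -> V) :
  subspace S -> (forall i, S (f i)) -> S (\sum_i c i *: f i).
Proof.
move=> [S0 Sl] Sf; apply: big_rec => // i x _; exact: Sl.
Qed.

(** Orthogonality to [l] imposes [size l] linear conditions on [size l + 1] coefficients, so the
    matrix [M] of inner products has a nonzero row in its left kernel. *)
Lemma infinite_dimensional_perp (S : V -> Prop) (l : seq V) :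
  subspace S -> infinite_dimensional S ->
  exists z, [/\ S z, z <> 0 & forall y, y \in l -> ip z y = 0].
Proof.
move=> Ssub Sinf; have [e [Se indep]] := Sinf (size l).+1.
pose M := \matrix_(i < (size l).+1, j < size l) ip (e i) l`_j.
have : kermx M != 0.
  rewrite -mxrank_eq0 mxrank_ker subn_eq0 -ltnNge ltnS.
  exact: rank_leq_col.
case/rowV0Pn => c /sub_kermxP cM c0.
exists (\sum_i c 0 i *: e i); split.
- exact: subspace_sum.
- move=> /indep h; case/eqP: c0; apply/rowP => i; rewrite mxE; exact: h.
- move=> y yl; rewrite ip_suml.
  have jl : (index y l < size l)%N by rewrite index_mem.
  move/matrixP/(_ 0 (Ordinal jl)): cM; rewrite !mxE => h; rewrite -[RHS]h.
  by apply: eq_bigr => i _; rewrite ipZl mxE /= nth_index.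
Qed.

(** Recursive choice, with [L n] collecting [l] and all vectors chosen before stage [n]. The
    subspace may vary with [n], so that one sequence can alternate between two ranges. *)
Lemma orthogonal_sequence (S : nat -> V -> Prop) (l : seq V) :
  (forall n, subspace (S n)) -> (forall n, infinite_dimensional (S n)) ->
  exists z : nat -> V, [/\ forall n, S n (z n), forall n, z n <> 0,
    forall n y, y \in l -> ip (z n) y = 0 &
    forall m n, m <> n -> ip (z m) (z n) = 0].
Proof.
move=> Ssub Sinf.
have /choice[g gP] (p : nat * seq V) :=
  infinite_dimensional_perp p.2 (Ssub p.1) (Sinf p.1).
pose L := fix L n := if n is m.+1 then g (m, L m) :: L m else l.
pose z n := g (n, L n).
have lL n y : y \in l -> y \in L n.
  by elim: n => //= n IH /IH; rewrite inE orbC => ->.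
have zL m n : (m < n)%N -> z m \in L n.
  elim: n => //= n IH; rewrite ltnS leq_eqVlt inE => /orP[/eqP->|/IH->].
    by rewrite eqxx.
  by rewrite orbT.
have zp n y : y \in L n -> ip (z n) y = 0 by case: (gP (n, L n)) => _ _; apply.
exists z; split.
- by move=> n; case: (gP (n, L n)).
- by move=> n; case: (gP (n, L n)).
- by move=> n y /(lL n) /zp.
- move=> m n /eqP; rewrite neq_ltn => /orP[] /zL /zp //; exact: ip_perpC.
Qed.

Lemma orthogonal_infinite (S : V -> Prop) (z : nat -> V) :
  (forall n, S (z n)) -> (forall n, z n <> 0) ->
  (forall m n, m <> n -> ip (z m) (z n) = 0) -> infinite_dimensional S.
Proof.
move=> Sz z0 zp n; exists (fun i : 'I_n => z i); split=> // c h i.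
have := congr1 (ip^~ (z i)) h; rewrite ip_suml ip0l (bigD1 i) //= big1.
  by rewrite addr0 ipZl => /eqP; rewrite mulf_eq0 (negPf (ip_neq0 (z0 i))) orbF => /eqP.
move=> j ji; rewrite ipZl zp ?mulr0 // => e.
by case/eqP: ji; apply: val_inj.
Qed.

Lemma subspace_range P : is_projection ip P ->
  subspace (fun y => exists x, P x = y).
Proof.
move=> pP; split; first by exists 0; rewrite (proj0 pP).
by move=> a _ _ [x <-] [y <-]; exists (a *: x + y); rewrite (projD pP) (projZ pP).
Qed.

Lemma proj_inf_sequence P (z : nat -> V) : is_projection ip P ->
  (forall n, P (z n) = z n) -> (forall n, z n <> 0) ->
  (forall m n, m <> n -> ip (z m) (z n) = 0) -> proj_inf ip P.
Proof.
move=> pP h z0 zp; split => //; apply: (orthogonal_infinite _ z0 zp).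
by move=> n; exists (z n).
Qed.

(** [U] carries an orthogonal sequence in the range of [P] to one in the range of [P']. The scalar
    map [s] lets this cover unitary and antiunitary maps as well as plain inclusions. *)
Lemma proj_inf_isometry (s : K -> K) (U P P' : V -> V) :
  s 0 = 0 -> (forall a, s a = 0 -> a = 0) ->
  (forall x y, ip (U x) (U y) = s (ip x y)) ->
  proj_inf ip P -> is_projection ip P' ->
  (forall x, P x = x -> P' (U x) = U x) -> proj_inf ip P'.
Proof.
move=> s0 si Uip [pP Pinf] pP' h.
have [z [zP z0 _ zp]] := orthogonal_sequence [::]
  (fun=> subspace_range pP) (fun=> Pinf).
apply: (@proj_inf_sequence P' (fun n => U (z n))) => // [n|n|m n mn].
- by apply: h; have [x <-] := zP n; rewrite (projK pP).
- move=> e; apply: (z0 n); apply: ip_eq0; apply: si.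
  by rewrite -Uip e ip0l.
- by rewrite Uip zp.
Qed.

Lemma proj_inf_le P Q : proj_inf ip P -> is_projection ip Q ->
  le_proj P Q -> proj_inf ip Q.
Proof.
move=> hP pQ l; apply: (@proj_inf_isometry id id P) => // x e.
by rewrite -e l.
Qed.

(** Choose one orthogonal sequence with odd terms in the range of [P] and even terms in that of [Q];
    [C] and [D] project onto the closed spans of the two halves. *)
Lemma orthogonal_subprojections P Q (l : seq V) :
  proj_inf ip P -> proj_inf ip Q ->
  exists C D, [/\ proj_inf ip C /\ proj_inf ip D, le_proj C P, le_proj D Q,
    orth C D & forall y, y \in l -> C y = 0 /\ D y = 0].
Proof.
move=> [pP Pinf] [pQ Qinf].
pose S n := if odd n then (fun y => exists x, P x = y)
                     else (fun y => exists x, Q x = y).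
have [|n|z [zS z0 zl zp]] := @orthogonal_sequence S l.
- by move=> n; rewrite /S; case: odd; exact: subspace_range.
- by rewrite /S; case: odd.
have zo m n : odd m -> ~~ odd n -> ip (z m) (z n) = 0.
  by move=> om on; apply: zp => e; move: on; rewrite -e om.
have sub R (b : bool) : is_projection ip R ->
    (forall n, odd n = b -> exists x, R x = z n) ->
    exists C, [/\ proj_inf ip C, le_proj C R,
      forall n, odd n = b -> C (z n) = z n &
      forall y, (forall n, odd n = b -> ip y (z n) = 0) -> C y = 0].
  move=> pR h.
  have [C [pC Cf Ck]] := exists_proj (fun y => exists2 n, odd n = b & y = z n).
  have Cz n : odd n = b -> C (z n) = z n by move=> e; apply: Cf; exists n.
  have Ck' y : (forall n, odd n = b -> ip y (z n) = 0) -> C y = 0.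
    by move=> hy; apply: Ck => _ [n e ->]; exact: hy.
  exists C; split => //.
    apply: (@proj_inf_sequence C (fun n => z (n.*2 + b)%N)) => // [n|m n mn].
      by apply: Cz; rewrite oddD odd_double; case: (b).
    apply: zp => /eqP; rewrite eqn_add2r => /eqP /double_inj; exact: mn.
  (* Pair [compl R (C u)] with [w] and move both projections across: [compl R w] is orthogonal to
     every [z n] of parity [b], so [C] kills it. *)
  move=> u; apply/esym/eqP; rewrite -subr_eq0; apply/eqP/ip_ext => w.
  rewrite -[_ - _]/(compl R (C u)) (projC (proj_compl pR)) (projC pC) Ck' ?ip0r ?ip0l //.
  move=> n /h[x <-]; rewrite /compl -(projC pR) (projD pR) (projN pR).
  by rewrite (projK pR) subrr ip0l.
have [|C [Ci CP Cz Ck]] := sub P true pP.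
  by move=> n on; have := zS n; rewrite /S on.
have [|D [Di DQ Dz Dk]] := sub Q false pQ.
  by move=> n on; have := zS n; rewrite /S on.
exists C, D; split => //.
  move=> u; apply: Ck => n on; rewrite (projC (proj1 Di)) Dk ?ip0r // => m om.
  by apply: zo; rewrite ?on ?om.
by move=> y yl; split; [apply: Ck | apply: Dk] => n _; apply/ip_perpC/zl.
Qed.

(** * Infinite rank and corank; adjoining and removing a line *)

Definition bi_inf P := proj_inf ip P /\ proj_inf ip (compl P).

Lemma bi_inf_proj P : bi_inf P -> is_projection ip P.
Proof. by case=> [[]]. Qed.

Lemma bi_inf_compl P : bi_inf P -> bi_inf (compl P).
Proof. by move=> [h h']; split => //; rewrite complK. Qed.

Lemma orth_le_compl P Q : orth P Q -> le_proj Q (compl P).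
Proof. by move=> o x; rewrite /compl o subr0. Qed.

Lemma bi_inf_orth P Q : proj_inf ip P -> proj_inf ip Q -> orth P Q -> bi_inf P.
Proof.
move=> hP hQ o; split => //; apply: proj_inf_le hQ (proj_compl (proj1 hP)) _.
exact: orth_le_compl.
Qed.

(** The complement of [A] contains an infinite rank projection [C] that kills [x]; it stays
    orthogonal to [padd A (line x)]. *)
Lemma bi_inf_addline A x : bi_inf A -> A x = 0 -> bi_inf (padd A (line x)).
Proof.
move=> hA Ax; have pA := bi_inf_proj hA.
have pQ := proj_padd pA (proj_line x) (orth_line pA Ax).
have [C [D [[Ci _] CA _ _ /(_ x)]]] :=
  orthogonal_subprojections [:: x] (proj2 hA) (proj2 hA).
rewrite mem_head => /(_ isT)[Cx _]; have pC := proj1 Ci.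
apply: (bi_inf_orth (Q := C)) => //.
  apply: proj_inf_le (proj1 hA) pQ _ => u; rewrite /padd (projK pA).
  by rewrite line_perp ?addr0 // (projC pA) Ax ip0r.
move=> u; rewrite /padd line_perp ?addr0; last by rewrite (projC pC) Cx ip0r.
by rewrite -CA /compl (projD pA) (projN pA) (projK pA) subrr.
Qed.

(** This is [R - line x], written with complements so that [bi_inf_addline] applies to [compl R]. *)
Definition subline R x := compl (padd (compl R) (line x)).

Lemma subline_fix R x : R x = x -> compl R x = 0.
Proof. by rewrite /compl => ->; rewrite subrr. Qed.

Lemma bi_inf_subline R x : bi_inf R -> R x = x -> bi_inf (subline R x).
Proof.
move=> hR Rx; apply/bi_inf_compl/bi_inf_addline; first exact: bi_inf_compl.
exact: subline_fix.
Qed.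

Lemma subline_eq0 R x : R x = x -> subline R x x = 0.
Proof. by move=> Rx; rewrite /subline /compl /padd Rx line_id subrr add0r subrr. Qed.

Lemma padd_subline R x : padd (subline R x) (line x) = R.
Proof.
by apply: funext => u; rewrite /padd /subline /compl opprD addrA subKr subrK.
Qed.

Lemma line_scale c v u : c != 0 -> line (c *: v) u = line v u.
Proof.
move=> c0; rewrite /line !ipE scalerA; have [->|/eqP v0] := eqVneq v 0.
  by rewrite !scaler0.
congr (_ *: _); field; rewrite c0 (ip_neq0 v0) andbT /=.
by rewrite fmorph_eq0.
Qed.

Lemma line_eq v w : w <> 0 -> w = line v w -> line v = line w.
Proof.
move=> w0; rewrite {1}/line; move: (_ / _) => c e; apply: funext => u.
rewrite e line_scale //; apply/eqP => c0; apply: w0.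
by rewrite e c0 scale0r.
Qed.

(** * Wigner's theorem *)

(** [a + cj a], twice the real part of [a], is the cross term in
    [|k + a|^2 = k^2 + k (a + cj a) + |a|^2]. *)
Lemma cj_trace_eq k a b : k != 0 -> cj k = k ->
  `|k + a| = `|k + b| -> `|a| = `|b| -> a + cj a = b + cj b.
Proof.
move=> k0 ck /(congr1 (fun z : K => z ^+ 2)) h /(congr1 (fun z : K => z ^+ 2)) h'.
move: h h'; rewrite -!mul_cj !rmorphD /= ck => h h'.
apply: (mulfI k0).
have -> : k * (a + cj a) = (k + a) * (k + cj a) - k ^+ 2 - a * cj a by ring.
by rewrite h h'; ring.
Qed.

(** [b] is a root of the quadratic with roots [a] and [cj a], whose coefficients are given by trace
    and norm. *)
Lemma cj_trace_norm a b : a + cj a = b + cj b -> `|a| = `|b| ->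
  b = a \/ b = cj a.
Proof.
move=> h /(congr1 (fun z : K => z ^+ 2)); rewrite -!mul_cj => h'.
have /eqP : (b - a) * (b - cj a) = 0.
  have -> : (b - a) * (b - cj a) = b ^+ 2 - b * (a + cj a) + a * cj a by ring.
  by rewrite h h'; ring.
by rewrite mulf_eq0 !subr_eq0 => /orP[] /eqP; [left | right].
Qed.

Section Wigner.
Variable T : V -> V.
Hypothesis norm_T : forall x y, `|ip (T x) (T y)| = `|ip x y|.
Hypothesis T_surj : forall v, exists x c, v = c *: T x.
Variable e : V.
Hypothesis e_neq0 : e <> 0.

Let k := ip e e.
Let e' := T e.
(* [F x] is the multiple of [T (e + x)] with [ip (F x) e' = k]; the locks keep
   [ipE] from looking inside. *)
Let F x := locked ((k / ip (T (e + x)) e') *: T (e + x)).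
Let U0 x := locked (F x - e').

Let k_neq0 : k != 0. Proof. exact: ip_neq0. Qed.

Let ip_T x : ip (T x) (T x) = ip x x.
Proof. by rewrite -[LHS]norm_ip norm_T norm_ip. Qed.

Let norm_Te x : ip x e = 0 -> `|ip (T (e + x)) e'| = k.
Proof. by move=> h; rewrite norm_T ipDl h addr0 norm_ip. Qed.

Let norm_F x v : ip x e = 0 -> `|ip (F x) v| = `|ip (T (e + x)) v|.
Proof.
move=> h; rewrite /F -lock ipZl normrM normrM normfV norm_Te // norm_ip divff ?mul1r //.
Qed.

Let F_e x : ip x e = 0 -> ip (F x) e' = k.
Proof.
move=> h; rewrite /F -lock ipZl divfK // -normr_eq0 norm_Te //.
Qed.

Let F_U0 x : F x = e' + U0 x.
Proof. by rewrite /U0 -lock addrC subrK. Qed.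

Let U0_e x : ip x e = 0 -> ip (U0 x) e' = 0.
Proof. by move=> h; rewrite /U0 -lock ipDl ipNl F_e // ip_T subrr. Qed.

(** [F x = e' + U0 x] with orthogonal summands, so [k + ip (U0 x) (U0 y)] is [ip (F x) (F y)]. This
    modulus together with that of [ip (U0 x) (U0 y)] determines the real part. *)
Let norm_kU0 x y : ip x e = 0 -> ip y e = 0 ->
  `|k + ip (U0 x) (U0 y)| = `|k + ip x y|.
Proof.
move=> hx hy.
have -> : k + ip (U0 x) (U0 y) = ip (F x) (F y).
  rewrite !F_U0 !ipE (U0_e hx) (ip_perpC (U0_e hy)) ip_T -/k; ring.
rewrite norm_F // norm_ipC norm_F // norm_T.
rewrite norm_ipC !ipE hx (ip_perpC hy); congr `|_|; rewrite /k; ring.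
Qed.

Let ip_U0 x : ip x e = 0 -> ip (U0 x) (U0 x) = ip x x.
Proof.
move=> h; have := norm_kU0 h h.
by rewrite !ger0_norm ?addr_ge0 ?ip_ge0 // => /addrI.
Qed.

(** [T x] is orthogonal to [e'], so [ip (U0 x) (T x)] equals [ip (F x) (T x)], of modulus [ip x x]:
    the equality case of Cauchy-Schwarz. *)
Let U0_T x : ip x e = 0 -> exists2 c, `|c| = 1 & U0 x = c *: T x.
Proof.
move=> h; have [x0|/eqP x0] := eqVneq x 0.
  exists 1; rewrite ?normr1 // scale1r.
  have -> : U0 x = 0 by apply: ip_eq0; rewrite ip_U0 // x0 ip0l.
  by apply/esym/ip_eq0; rewrite ip_T x0 ip0l.
have Tx0 : T x <> 0.
  by move=> /(congr1 (fun v => ip v v)); rewrite ip_T ip0l => /ip_eq0.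
have hTx : ip e' (T x) = 0.
  by apply/eqP; rewrite -normr_eq0 norm_T (ip_perpC h) normr0.
have hU : `|ip (U0 x) (T x)| = ip x x.
  have -> : ip (U0 x) (T x) = ip (F x) (T x) by rewrite F_U0 ipDl hTx add0r.
  by rewrite norm_F // norm_T ipDl (ip_perpC h) add0r norm_ip.
have e1 := @cauchy_schwarz_eq (U0 x) (T x) Tx0.
exists (ip (U0 x) (T x) / ip (T x) (T x)).
  by rewrite normrM normfV hU norm_ip ip_T divff ?ip_neq0.
by apply: e1; rewrite hU ip_U0 // ip_T expr2.
Qed.

Let norm_U0 x y : ip x e = 0 -> ip y e = 0 ->
  `|ip (U0 x) (U0 y)| = `|ip x y|.
Proof.
move=> /U0_T[c c1 ->] /U0_T[d d1 ->].
by rewrite ipZl ipZr !normrM norm_cj c1 d1 !mul1r norm_T.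
Qed.

Let trace_U0 x y : ip x e = 0 -> ip y e = 0 ->
  ip (U0 x) (U0 y) + ip (U0 y) (U0 x) = ip x y + ip y x.
Proof.
move=> hx hy; rewrite (ipC (U0 x)) (ipC x).
apply: (cj_trace_eq (k := k)) => //; first exact: cj_ipxx.
  exact: norm_kU0.
exact: norm_U0.
Qed.

Let perpD x y : ip x e = 0 -> ip y e = 0 -> ip (x + y) e = 0.
Proof. by move=> h h'; rewrite ipDl h h' addr0. Qed.

Let perpZ a x : ip x e = 0 -> ip (a *: x) e = 0.
Proof. by move=> h; rewrite ipZl h mulr0. Qed.

(** The squared norm of [U0 (x + y) - U0 x - U0 y] involves only norms and real parts of inner
    products, all preserved by [U0]; without [U0] the same expression is zero. *)
Let U0_D x y : ip x e = 0 -> ip y e = 0 -> U0 (x + y) = U0 x + U0 y.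
Proof.
move=> hx hy; have hz := perpD hx hy.
apply/eqP; rewrite -subr_eq0; apply/eqP/ip_eq0.
have -> : ip (U0 (x + y) - (U0 x + U0 y)) (U0 (x + y) - (U0 x + U0 y)) =
   ip (U0 (x + y)) (U0 (x + y)) + ip (U0 x) (U0 x) + ip (U0 y) (U0 y)
   + (ip (U0 x) (U0 y) + ip (U0 y) (U0 x))
   - (ip (U0 (x + y)) (U0 x) + ip (U0 x) (U0 (x + y)))
   - (ip (U0 (x + y)) (U0 y) + ip (U0 y) (U0 (x + y))) by rewrite !ipE; ring.
rewrite !trace_U0 // !ip_U0 // !ipE; ring.
Qed.

(** Equality in Cauchy-Schwarz makes [U0 (a *: x)] a multiple of [U0 x]; the trace and modulus of
    the coefficient agree with those of [a]. *)
Let U0_Z a x : ip x e = 0 -> U0 (a *: x) = a *: U0 x \/ U0 (a *: x) = cj a *: U0 x.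
Proof.
move=> hx; have hax := perpZ a hx.
have [x0|/eqP x0] := eqVneq x 0.
  left; rewrite x0 scaler0.
  suff -> : U0 0 = 0 by rewrite scaler0.
  by apply: ip_eq0; rewrite ip_U0 ip0l.
have Ux0 : U0 x <> 0.
  by move=> /(congr1 (fun v => ip v v)); rewrite ip_U0 // ip0l => /ip_eq0.
have -> : U0 (a *: x) = line (U0 x) (U0 (a *: x)).
  apply: cauchy_schwarz_eq => //.
  by rewrite norm_U0 // !ip_U0 // ipZl normrM norm_ip exprMn -mul_cj !ipE; ring.
rewrite /line ip_U0 //.
have [||->|->] := @cj_trace_norm (ip (a *: x) x) (ip (U0 (a *: x)) (U0 x)).
- by rewrite -!ipC trace_U0.
- by rewrite norm_U0.
- by left; rewrite ipZl mulfK ?ip_neq0.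
- by right; rewrite ipZl rmorphM /= cj_ipxx mulfK ?ip_neq0.
Qed.

(* A group is not the union of two proper subgroups: here applied to the
   additive group of scalars, and in [U0_semilinear] to that of vectors. *)
Let U0_Zx x : ip x e = 0 ->
  (forall a, U0 (a *: x) = a *: U0 x) \/ (forall a, U0 (a *: x) = cj a *: U0 x).
Proof.
move=> hx; have [h|] := pselect (forall a, U0 (a *: x) = a *: U0 x); first by left.
move=> /existsNP[a na]; right => b.
have [hb|//] := U0_Z b hx.
have [ha|ha] := U0_Z a hx; first by [].
have := U0_Z (a + b) hx.
rewrite scalerDl U0_D ?perpZ // ha hb rmorphD /= !scalerDl => -[].
  by move/addIr => e1; case: na; rewrite ha.
by move/addrI => e1; rewrite e1.
Qed.

Let U0_semilinear : exists s : {rmorphism K -> K}, [/\ s = idfun :> (K -> K) \/ s = cj,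
  forall a x, ip x e = 0 -> U0 (a *: x) = s a *: U0 x &
  forall x y, ip x e = 0 -> ip y e = 0 -> ip (U0 x) (U0 y) = s (ip x y)].
Proof.
have tr x y : ip x e = 0 -> ip y e = 0 ->
    ip (U0 x) (U0 y) = ip x y \/ ip (U0 x) (U0 y) = cj (ip x y).
  move=> hx hy; apply: cj_trace_norm; last by rewrite norm_U0.
  by rewrite -!ipC trace_U0.
(* For the case where the inner product behaves unlike the scalars: [trace_U0] at [z *: x] and [y],
   with [z = ip x y], then shows that [z] is self-conjugate, so both behaviours coincide. *)
have cj_eq (z : K) : z * cj z + cj z * z = z * z + cj z * cj z -> cj z = z.
  move=> h; apply/esym/eqP; rewrite -subr_eq0 -sqrf_eq0.
  have -> : (z - cj z) ^+ 2 = z * z + cj z * cj z - (z * cj z + cj z * z) by ring.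
  by rewrite h subrr.
have [h|] := pselect (forall a x, ip x e = 0 -> U0 (a *: x) = a *: U0 x).
  exists idfun; split => //; first by left.
  move=> x y hx hy; have [//|e1] := tr x y hx hy; rewrite e1 /=.
  apply: cj_eq; have := trace_U0 (perpZ (ip x y) hx) hy.
  by rewrite h // !ipE (ipC x y) (ipC (U0 x)) e1 !cjK => <-; ring.
move=> /existsNP[a /existsNP[x nax]].
have hx : ip x e = 0 by apply: contrapT => hx; apply: nax.
have hax : U0 (a *: x) <> a *: U0 x by move=> h; apply: nax.
have Ax b : U0 (b *: x) = cj b *: U0 x.
  by have [/(_ a)|//] := U0_Zx hx.
(* If [U0] were linear along [y], then linearity along [x + y] would contradict the choice of [a],
   and conjugate linearity there forces it along [y]. *)
have hA b y : ip y e = 0 -> U0 (b *: y) = cj b *: U0 y.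
  move=> hy; have [Ly|//] := U0_Zx hy; rewrite Ly.
  have [] := U0_Zx (perpD hx hy).
    move=> /(_ a); rewrite scalerDr !U0_D ?perpZ // Ly scalerDr => /addIr.
    by move=> e1; case: hax.
  move=> /(_ b); rewrite scalerDr !U0_D ?perpZ // Ax Ly scalerDr => /addrI.
  by [].
exists cj; split => //; first by right.
move=> y z hy hz; have [e1|//] := tr y z hy hz; rewrite e1; apply/esym.
apply: cj_eq; have := trace_U0 (perpZ (ip y z) hy) hz.
by rewrite hA // !ipE (ipC y z) (ipC (U0 y)) e1 !cjK => <-; ring.
Qed.

(** Extend [U0] from the orthogonal complement of [e] by sending [e] to [e'], [s]-semilinearly. *)
Lemma wigner : exists U : V -> V,
  (unitary ip U \/ antiunitary cj ip U) /\ forall x, exists c, U x = c *: T x.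
Proof.
have [s [s_eq U0Z Uip]] := U0_semilinear.
have cjs a : cj (s a) = s (cj a) by case: s_eq => ->.
have sK a : s (s a) = a by case: s_eq => -> //=.
have cjk : cj k = k by exact: cj_ipxx.
have sk : s k = k by case: s_eq => ->.
pose al x := ip x e / k.
have [pr prE] : exists pr, forall x, pr x = x - al x *: e by eexists.
have pr_e x : ip (pr x) e = 0 by rewrite prE ipDl ipNl ipZl divfK // subrr.
have [U UE] : exists U, forall x, U x = s (al x) *: e' + U0 (pr x) by eexists.
have decE x : x = al x *: e + pr x by rewrite prE addrC subrK.
have al_lin a x y : al (a *: x + y) = a * al x + al y.
  by rewrite /al ip_lin mulrDl mulrA.
have pr_lin a x y : pr (a *: x + y) = a *: pr x + pr y.
  by rewrite !prE al_lin; apply: ip_ext => z; rewrite !ipE; ring.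
have U_lin : Defs.semilinear s U.
  move=> a x y; rewrite !UE al_lin pr_lin U0_D ?perpZ // U0Z // rmorphD rmorphM.
  by apply: ip_ext => z; rewrite !ipE; ring.
have U_ip x y : ip (U x) (U y) = s (ip x y).
  rewrite {2}(decE x) {2}(decE y) !UE !ipE pr_e (ip_perpC (pr_e y)).
  rewrite U0_e // (ip_perpC (U0_e (pr_e y))) Uip // ip_T cjs.
  by rewrite !(rmorphD, rmorphM, rmorph0) /= -/k sk; ring.
have U_T x : exists c, U x = c *: T x.
  have [x0|/eqP x0] := eqVneq x 0.
    exists 0; rewrite scale0r; apply: ip_eq0; rewrite U_ip x0 ip0l.
    exact: rmorph0.
  have [a0|a0] := eqVneq (al x) 0.
    have xp : pr x = x by rewrite [RHS]decE a0 scale0r add0r.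
    have hx : ip x e = 0 by rewrite -xp.
    have [c _ h] := U0_T hx; exists c.
    by rewrite UE a0 rmorph0 scale0r add0r xp.
  (* Now [x] is [al x *: (e + y)] and [U x] is [s (al x) *: F y], a multiple of [T (e + y)], which
     is parallel to [T x] by equality in Cauchy-Schwarz. *)
  pose y := (al x)^-1 *: pr x.
  have hy : ip y e = 0 by exact: perpZ.
  have xy : e + y = (al x)^-1 *: x.
    by rewrite {2}(decE x) scalerDr scalerA mulVf // scale1r.
  have Uy : U x = s (al x) *: F y.
    rewrite UE F_U0 scalerDr /y U0Z // scalerA -rmorphM mulfV // rmorph1 scale1r //.
  have Tx0 : T x <> 0.
    by move=> /(congr1 (fun v => ip v v)); rewrite ip_T ip0l => /ip_eq0.
  have : T (e + y) = line (T x) (T (e + y)).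
    apply: cauchy_schwarz_eq => //; rewrite norm_T !ip_T xy ipZl normrM norm_ip.
    by rewrite exprMn -mul_cj !ipE; ring.
  rewrite /line => h; rewrite Uy /F -lock h !scalerA; eexists; reflexivity.
exists U; split => //.
suff iso : isometric_onto ip s U.
  case: s_eq => e1; [left | right]; move: iso; rewrite /unitary /antiunitary e1 //.
split => // v; have [x [c ->]] := T_surj v; have [d dx] := U_T x.
have [x0|/eqP x0] := eqVneq x 0.
  have -> : T x = 0 by apply: ip_eq0; rewrite ip_T x0 ip0l.
  by exists 0; rewrite scaler0; apply: ip_eq0; rewrite U_ip ip0l rmorph0.
have d0 : d != 0.
  apply/eqP => d0; apply: x0; apply: ip_eq0.
  by rewrite -[LHS]sK -U_ip dx d0 scale0r ip0l rmorph0.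
exists (s (c / d) *: x + 0); rewrite U_lin sK dx scalerA divfK //.
have -> : U 0 = 0 by apply: ip_eq0; rewrite U_ip ip0l rmorph0.
by rewrite addr0.
Qed.

End Wigner.

(** * Maps preserving angles *)

Lemma unitary_inv W W' : unitary ip W -> cancel W W' -> cancel W' W ->
  unitary ip W'.
Proof.
move=> [Wl _ Wip] WK WK'; split.
- by move=> a x y; rewrite -{1}(WK' x) -{1}(WK' y) -Wl WK.
- by move=> x; exists (W x).
- by move=> x y; rewrite -Wip !WK'.
Qed.

Lemma same_angle_sym P Q P' Q' : same_angle ip P Q P' Q' ->
  same_angle ip P' Q' P Q.
Proof.
move=> [W [W' [uW WK WK' h]]]; exists W', W; split => //.
  exact: unitary_inv WK WK'.
by move=> x; rewrite h !WK.
Qed.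

Lemma unitary0 W : unitary ip W -> W 0 = 0.
Proof. by move=> [_ _ Wip]; apply: ip_eq0; rewrite Wip ip0l. Qed.

Lemma unitary_line W W' x u : unitary ip W -> cancel W' W ->
  W (line x (W' u)) = line (W x) u.
Proof.
move=> uW WK'; have [Wl _ Wip] := uW.
rewrite /line Wip -[X in _ = (ip X _ / _) *: _]WK' Wip.
by rewrite -[X in W X]addr0 Wl unitary0 // addr0.
Qed.

Lemma orth_compress P Q : is_projection ip P -> is_projection ip Q ->
  (forall x, Q (P (Q x)) = 0) -> orth P Q.
Proof.
move=> pP pQ h x; apply: (proj_perp pP).
by rewrite -(projC pQ) h ip0l.
Qed.

Lemma same_angle_orth P Q P' Q' : is_projection ip Q ->
  is_projection ip P' -> is_projection ip Q' ->
  same_angle ip P Q P' Q' -> orth P Q -> orth P' Q'.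
Proof.
move=> pQ pP' pQ' [W [W' [uW WK WK' h]]] o; apply: orth_compress => // x.
by rewrite h o (proj0 pQ) unitary0.
Qed.

(** Idempotence of [QPQ] gives [|QPQ x| = |PQ x|], so [Q] fixes [PQ x]; then [PQ = QPQ] is
    self-adjoint. *)
Lemma compress_idem_comm P Q : is_projection ip P -> is_projection ip Q ->
  (forall x, Q (P (Q (Q (P (Q x))))) = Q (P (Q x))) ->
  forall x, P (Q x) = Q (P x).
Proof.
move=> pP pQ h.
have e x : Q (P (Q x)) = P (Q x).
  apply: (proj_fix pQ).
  have -> : ip (P (Q x)) (P (Q x)) = ip (Q (P (Q x))) x.
    by rewrite (projC pQ) (projC pP (Q x) (Q x)) (projC pP) (projK pP).
  by rewrite -[in RHS]h [RHS](projC pQ) [RHS](projC pP) (projK pQ).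
move=> x; apply: ip_ext => y.
by rewrite -e [LHS](projC pQ) [LHS](projC pP) [LHS](projC pQ) e (projC pQ) (projC pP).
Qed.

Section Phi.
Variable phi : (V -> V) -> (V -> V).
Hypothesis V_inf : infinite_dimensional (fun _ : V => True).
Hypothesis phi_inf : forall P, proj_inf ip P -> proj_inf ip (phi P).
Hypothesis phi_surj : forall Q, proj_inf ip Q -> exists P, proj_inf ip P /\ phi P = Q.
Hypothesis phi_angle : forall P Q, proj_inf ip P -> proj_inf ip Q ->
  same_angle ip P Q (phi P) (phi Q).

Lemma phi_orth P Q : proj_inf ip P -> proj_inf ip Q ->
  orth P Q <-> orth (phi P) (phi Q).
Proof.
move=> hP hQ; have [pP _] := hP; have [pQ _] := hQ.
have [pP' _] := phi_inf hP; have [pQ' _] := phi_inf hQ.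
have h := phi_angle hP hQ.
by split; apply: same_angle_orth => //; exact: same_angle_sym.
Qed.

(** For equal arguments the compression is [P] itself, so [W] maps the kernel of [P] into that of
    [P']. *)
Lemma same_angle_compl_inf P P' : is_projection ip P -> is_projection ip P' ->
  same_angle ip P P P' P' -> proj_inf ip (compl P) -> proj_inf ip (compl P').
Proof.
move=> pP pP' [W [W' [uW WK WK' h]]] hP; have [_ _ Wip] := uW.
apply: (@proj_inf_isometry id W (compl P)) => //; first exact: proj_compl.
move=> x; rewrite /compl => e; suff -> : P' (W x) = 0 by rewrite subr0.
have e' : P x = 0 by rewrite -e (projD pP) (projN pP) (projK pP) subrr.
by rewrite -(projK pP') -(projK pP' (P' _)) h WK e' (proj0 pP) (proj0 pP) unitary0.
Qed.

Lemma phi_bi_inf P : proj_inf ip P -> bi_inf P <-> bi_inf (phi P).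
Proof.
move=> hP; have [pP _] := hP; have [pP' _] := phi_inf hP.
split=> -[_ h]; split => //; first exact: phi_inf.
  exact: same_angle_compl_inf (phi_angle hP hP) h.
apply: same_angle_compl_inf h => //.
exact/same_angle_sym/phi_angle.
Qed.

Lemma phi_bi P : bi_inf P -> bi_inf (phi P).
Proof. by move=> h; apply/(phi_bi_inf (proj1 h)). Qed.

Lemma phi_bi_surj Q : bi_inf Q -> exists2 P, bi_inf P & phi P = Q.
Proof.
move=> hQ; have [P [hP e]] := phi_surj (proj1 hQ); exists P => //.
by apply/(phi_bi_inf hP); rewrite e.
Qed.

Lemma le_orth P Q Z : le_proj P Q -> orth Z Q -> orth Z P.
Proof. by move=> l o x; rewrite -l o. Qed.

Lemma orth_compl P : is_projection ip P -> orth (compl P) P.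
Proof. by move=> pP x; rewrite /compl (projK pP) subrr. Qed.

(** By surjectivity the complement of [phi Q] is some [phi Z]; orthogonality pulls back to [Z] and
    [Q], restricts to [P], and is pushed forward again. *)
Lemma phi_le P Q : proj_inf ip P -> bi_inf Q ->
  le_proj P Q -> le_proj (phi P) (phi Q).
Proof.
move=> hP bQ l; have bQ' := phi_bi bQ; have hP' := phi_inf hP.
apply/le_orth_compl.
have [Z [hZ e]] := phi_surj (proj2 bQ'); rewrite -e.
apply/(phi_orth hZ hP); apply: le_orth l _.
apply/(phi_orth hZ (proj1 bQ)); rewrite e; apply: orth_compl; exact: bi_inf_proj.
Qed.

Lemma phi_compl P : bi_inf P -> phi (compl P) = compl (phi P).
Proof.
move=> bP; have bP' := phi_bi bP; have bC := bi_inf_compl bP.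
have pP := bi_inf_proj bP; have pP' := bi_inf_proj bP'.
have pC := bi_inf_proj (phi_bi bC).
apply: le_proj_anti => //; first exact: proj_compl.
  apply: orth_le_compl; apply: (orthC pC pP').
  by apply/(phi_orth (proj1 bC) (proj1 bP)); exact: orth_compl.
have [Z [hZ e]] := phi_surj (proj2 bP'); rewrite -e; apply: phi_le => //.
apply: orth_le_compl; apply: (orthC (proj1 hZ) pP).
by apply/(phi_orth hZ (proj1 bP)); rewrite e; exact: orth_compl.
Qed.

Lemma phi_le_inv P Q : proj_inf ip P -> bi_inf Q ->
  le_proj (phi P) (phi Q) -> le_proj P Q.
Proof.
move=> hP bQ /le_orth_compl.
by rewrite -phi_compl // => /(phi_orth (proj2 bQ) hP) /le_orth_compl.
Qed.

(** * The effect of [phi] on adjoining a line *)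

Lemma addline_le A x : is_projection ip A -> A x = 0 -> le_proj A (padd A (line x)).
Proof.
move=> pA Ax u; rewrite /padd (projK pA) line_perp ?addr0 //.
by rewrite (projC pA) Ax ip0r.
Qed.

Lemma compress_compl A Q u : is_projection ip A -> is_projection ip Q ->
  le_proj A Q -> Q (compl A (Q u)) = Q u - A u.
Proof.
move=> pA pQ l; rewrite /compl (projD pQ) (projN pQ) (projK pQ) l.
by rewrite (le_projC pA pQ l).
Qed.

Lemma phi_addline A x : bi_inf A -> A x = 0 -> exists v,
  [/\ ip v v = ip x x, phi A v = 0 & phi (padd A (line x)) = padd (phi A) (line v)].
Proof.
move=> bA Ax; have pA := bi_inf_proj bA; have bQ := bi_inf_addline bA Ax.
set Q := padd A (line x) in bQ *.
have pQ := bi_inf_proj bQ; have lAQ : le_proj A Q by exact: addline_le.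
have lAQ' := phi_le (proj1 bA) bQ lAQ.
have pA' := bi_inf_proj (phi_bi bA); have pQ' := bi_inf_proj (phi_bi bQ).
have [W [W' [uW WK WK' h]]] := phi_angle (proj2 bA) (proj1 bQ).
have [_ _ Wip] := uW.
have e u : phi Q u = phi A u + line (W x) u.
  have := h u; rewrite phi_compl // !compress_compl //.
  have -> : Q (W' u) - A (W' u) = line x (W' u) by rewrite /Q /padd addrC addKr.
  by rewrite unitary_line // => <-; rewrite addrC subrK.
exists (W x); split; [by rewrite Wip | | by apply: funext => u; rewrite e].
have := e (W x); rewrite line_id => e'.
have := le_projC pA' pQ' lAQ' (W x); rewrite e' (projD pA') (projK pA').
by rewrite -[RHS]addr0 => /addrI.
Qed.

Lemma compress_lines A A' x y u : is_projection ip A -> is_projection ip A' ->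
  orth A A' -> A x = 0 -> A y = 0 -> A' x = 0 -> A' y = 0 ->
  padd A (line x) (padd A' (line y) (padd A (line x) u))
    = line x (line y (line x u)).
Proof.
move=> pA pA' o Ax Ay A'x A'y; have o' := orthC pA pA' o.
rewrite /padd (projD pA') o' (orth_line pA' A'x) addr0.
rewrite (projD (proj_line y)) (@line_perp y (A u)); last by rewrite (projC pA) Ay ip0r.
by rewrite add0r add0r (orth_line pA Ay) add0r.
Qed.

(** [W x] is fixed by the compression of [phi P] to [phi Q], hence by both. It is killed by [phi A]
    and [phi A'], since [A] is orthogonal to [P] and [A'] to [Q]; so it lies on both lines. *)
Lemma phi_addline_orth A A' x v v' : bi_inf A -> bi_inf A' -> orth A A' ->
  A x = 0 -> A' x = 0 -> ip v v = ip x x -> ip v' v' = ip x x ->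
  phi (padd A (line x)) = padd (phi A) (line v) ->
  phi (padd A' (line x)) = padd (phi A') (line v') ->
  line v = line v'.
Proof.
move=> bA bA' o Ax A'x Nv Nv' ev ev'.
have [x0|/eqP x0] := eqVneq x 0.
  have -> : v = 0 by apply: ip_eq0; rewrite Nv x0 ip0l.
  by have -> : v' = 0 by apply: ip_eq0; rewrite Nv' x0 ip0l.
have pA := bi_inf_proj bA; have pA' := bi_inf_proj bA'.
have o' := orthC pA pA' o.
have bQ := bi_inf_addline bA Ax; have bP := bi_inf_addline bA' A'x.
set Q := padd A (line x) in bQ ev *; set P := padd A' (line x) in bP ev' *.
have pP' := bi_inf_proj (phi_bi bP); have pQ' := bi_inf_proj (phi_bi bQ).
have [W [W' [uW WK WK' h]]] := phi_angle (proj1 bP) (proj1 bQ).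
have [_ _ Wip] := uW.
have w0 : W x <> 0 by move=> /(congr1 W'); rewrite WK -(unitary0 uW) WK.
have hw : phi Q (phi P (phi Q (W x))) = W x.
  by rewrite h WK /Q /P compress_lines // !line_id.
have Qw : phi Q (W x) = W x by rewrite -{1}hw (projK pQ') hw.
have Pw : phi P (W x) = W x.
  by apply: (proj_fix pP'); rewrite -{2}Qw -(projC pQ') -{1}Qw hw.
have oAP : orth A P.
  by move=> u; rewrite /P /padd (projD pA) o (orth_line pA Ax) addr0.
have oA'Q : orth A' Q.
  by move=> u; rewrite /Q /padd (projD pA') o' (orth_line pA' A'x) addr0.
have Aw : phi A (W x) = 0.
  by rewrite -Pw; apply: (proj1 (phi_orth (proj1 bA) (proj1 bP)) oAP).
have A'w : phi A' (W x) = 0.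
  by rewrite -Qw; apply: (proj1 (phi_orth (proj1 bA') (proj1 bQ)) oA'Q).
rewrite (line_eq w0 (v := v)); last by rewrite -{1}Qw ev /padd Aw add0r.
by rewrite (line_eq w0 (v := v')) // -{1}Pw ev' /padd A'w add0r.
Qed.

Lemma phi_addline_indep A A' x v v' : bi_inf A -> bi_inf A' ->
  A x = 0 -> A' x = 0 -> ip v v = ip x x -> ip v' v' = ip x x ->
  phi (padd A (line x)) = padd (phi A) (line v) ->
  phi (padd A' (line x)) = padd (phi A') (line v') ->
  line v = line v'.
Proof.
move=> bA bA' Ax A'x Nv Nv' ev ev'.
(* A smaller [D] yields the same line as [B]: compare both with [C], the complement of [B + [x]],
   which kills [x] and is orthogonal to [B] and [D]. *)
have sub D B w u : bi_inf D -> bi_inf B -> le_proj D B -> B x = 0 ->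
    ip w w = ip x x -> ip u u = ip x x ->
    phi (padd D (line x)) = padd (phi D) (line w) ->
    phi (padd B (line x)) = padd (phi B) (line u) -> line u = line w.
  move=> bD bB l Bx Nw Nu ew eu.
  have pB := bi_inf_proj bB; have pD := bi_inf_proj bD.
  have Dx : D x = 0 by rewrite -(le_projC pD pB l) Bx (proj0 pD).
  pose C := compl (padd B (line x)).
  have bC : bi_inf C by apply/bi_inf_compl/bi_inf_addline.
  have pC := bi_inf_proj bC.
  have Cx : C x = 0 by rewrite /C /compl /padd Bx line_id add0r subrr.
  have oCB : orth C B.
    move=> y; rewrite /C /compl /padd (projK pB) line_perp ?addr0 ?subrr //.
    by rewrite (projC pB) Bx ip0r.
  have oCD : orth C D by exact: le_orth oCB.
  have [t [Nt _ et]] := phi_addline bC Cx.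
  rewrite -(phi_addline_orth bC bB oCB Cx Bx Nt Nu et eu).
  exact: (phi_addline_orth bC bD oCD Cx Dx Nt Nw et ew).
have [D [D' [[hD hD'] lD lD' o _]]] :=
  orthogonal_subprojections [::] (proj1 bA) (proj1 bA').
have o' := orthC (proj1 hD) (proj1 hD') o.
have bD := bi_inf_orth hD hD' o; have bD' := bi_inf_orth hD' hD o'.
have pD := bi_inf_proj bD; have pD' := bi_inf_proj bD'.
have pA := bi_inf_proj bA; have pA' := bi_inf_proj bA'.
have Dx : D x = 0 by rewrite -(le_projC pD pA lD) Ax (proj0 pD).
have D'x : D' x = 0 by rewrite -(le_projC pD' pA' lD') A'x (proj0 pD').
have [w [Nw _ ew]] := phi_addline bD Dx.
have [w' [Nw' _ ew']] := phi_addline bD' D'x.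
rewrite (sub D A w v) // (sub D' A' w' v') //.
exact: (phi_addline_orth bD bD' o Dx D'x Nw Nw' ew ew').
Qed.

(** * Images of vectors and transition probabilities *)

Lemma proj_inf_id : proj_inf ip id.
Proof.
split; first exact: mk_projection.
move=> n; have [e [_ h]] := V_inf n; exists e; split => // i; by exists (e i).
Qed.

Lemma orthogonal_pair (l : seq V) : exists C D, [/\ bi_inf C, bi_inf D,
  orth C D & forall y, y \in l -> C y = 0 /\ D y = 0].
Proof.
have [C [D [[hC hD] _ _ o h]]] :=
  orthogonal_subprojections l proj_inf_id proj_inf_id.
exists C, D; split => //; first exact: bi_inf_orth hD o.
exact: bi_inf_orth hC (orthC (proj1 hC) (proj1 hD) o).
Qed.

(** [v] spans the image of the line of [x] and has the length of [x]; its phase is left free. *)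
Definition vector_image x v := ip v v = ip x x /\
  forall A, bi_inf A -> A x = 0 ->
    phi A v = 0 /\ phi (padd A (line x)) = padd (phi A) (line v).

Lemma exists_vector_image x : exists v, vector_image x v.
Proof.
have [A0 [A1 [bA0 _ _ /(_ x)]]] := orthogonal_pair [:: x].
rewrite mem_head => /(_ isT)[A0x _].
have [v [Nv _ ev]] := phi_addline bA0 A0x; exists v; split=> // A bA Ax.
have [w [Nw Aw ew]] := phi_addline bA Ax.
have e : line v = line w by exact: phi_addline_indep ev ew.
split; last by rewrite e.
by rewrite -[v]line_id e (projZ (bi_inf_proj (phi_bi bA))) Aw scaler0.
Qed.

(** [R] is [subline R x] with the line of [x] adjoined, so [phi R] contains the line of [v]. *)
Lemma vector_image_fix x v R : vector_image x v -> bi_inf R -> R x = x ->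
  phi R v = v.
Proof.
move=> [_ h] bR Rx.
have [Av e] := h _ (bi_inf_subline bR Rx) (subline_eq0 Rx).
by move: e; rewrite padd_subline => ->; rewrite /padd Av add0r line_id.
Qed.

Lemma vector_image_perp x v R : vector_image x v -> bi_inf R -> R x = 0 ->
  phi R v = 0.
Proof. by move=> [_ h] bR /(h _ bR)[]. Qed.

Lemma line3 x y u : line x (line y (line x u)) =
  (`|ip x y| ^+ 2 / (ip x x * ip y y)) *: line x u.
Proof.
rewrite /line !ipE !scalerA; congr (_ *: _).
by rewrite -mul_cj (ipC x y) invfM; ring.
Qed.

Lemma vector_image_norm x y v w : vector_image x v -> vector_image y w ->
  `|ip v w| = `|ip x y|.
Proof.
move=> [Nv hv] [Nw hw].
have [x0|/eqP x0] := eqVneq x 0.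
  have -> : v = 0 by apply: ip_eq0; rewrite Nv x0 ip0l.
  by rewrite x0 !ip0l.
have [y0|/eqP y0] := eqVneq y 0.
  have -> : w = 0 by apply: ip_eq0; rewrite Nw y0 ip0l.
  by rewrite y0 !ip0r.
have [A [A' [bA bA' o h]]] := orthogonal_pair [:: x; y].
have [Ax A'x] := h x (mem_head _ _).
have [Ay A'y] : A y = 0 /\ A' y = 0 by apply: h; rewrite !inE eqxx orbT.
have [Av eQ] := hv A bA Ax; have [A'w eP] := hw A' bA' A'y.
have [Aw _] := hw A bA Ay; have [A'v _] := hv A' bA' A'x.
have bQ := bi_inf_addline bA Ax; have bP := bi_inf_addline bA' A'y.
have [W [W' [uW WK WK' ha]]] := phi_angle (proj1 bP) (proj1 bQ).
have [Wl _ Wip] := uW.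
have WZ a t : W (a *: t) = a *: W t by rewrite -[a *: t]addr0 Wl unitary0 // addr0.
have pA := bi_inf_proj bA; have pA' := bi_inf_proj bA'.
have pA2 := bi_inf_proj (phi_bi bA); have pA'2 := bi_inf_proj (phi_bi bA').
have o2 : orth (phi A) (phi A').
  exact: (proj1 (phi_orth (proj1 bA) (proj1 bA')) o).
pose c := `|ip x y| ^+ 2 / (ip x x * ip y y).
pose c' := `|ip v w| ^+ 2 / (ip x x * ip y y).
have E u : c' *: line v u = c *: line (W x) u.
  have := ha u; rewrite eQ eP !compress_lines // !line3 WZ (unitary_line _ _ uW WK').
  by rewrite Nv Nw.
have v0 : v <> 0.
  by move=> e; apply: x0; apply: ip_eq0; rewrite -Nv e ip0l.
have Wx0 : W x <> 0 by move=> /(congr1 W'); rewrite WK -(unitary0 uW) WK.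
(* Two multiples of rank one projections coincide: either both coefficients vanish, or [v] is
   parallel to [W x] and the projections agree. *)
have cc : c' = c.
  have [c'0|c'0] := eqVneq c' 0.
    have := E (W x); rewrite c'0 scale0r line_id => /esym/eqP.
    by rewrite scaler_eq0 => /orP[/eqP|/eqP].
  have [b vb] : exists b, v = b *: W x.
    have := congr1 (GRing.scale c'^-1) (E v).
    rewrite line_id scalerA mulVf // scale1r /line !scalerA => e.
    by rewrite e; eexists.
  have b0 : b != 0 by apply/eqP => b0; apply: v0; rewrite vb b0 scale0r.
  have := E (W x); rewrite vb line_scale // line_id => /eqP.
  by rewrite -subr_eq0 -scalerBl scaler_eq0 subr_eq0 => /orP[/eqP|/eqP].
have n0 : ip x x * ip y y != 0 by rewrite mulf_neq0 ?ip_neq0.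
apply/eqP; rewrite -(eqrXn2 (n := 2)) //; apply/eqP.
by apply: (mulIf (invr_neq0 n0)).
Qed.

(** Pull [A'] and [A' + [v]] back to [A <= Q]; the angle of [compl A] and [Q] shows that [Q - A] is
    the line of [W v]. *)
Lemma vector_image_surj v :
  exists x, forall u, vector_image x u -> line u = line v.
Proof.
have [A' [A1 [bA' _ _ /(_ v)]]] := orthogonal_pair [:: v].
rewrite mem_head => /(_ isT)[A'v _].
have [A bA eA] := phi_bi_surj bA'.
have bQ' := bi_inf_addline bA' A'v; have [Q bQ eQ] := phi_bi_surj bQ'.
have pA := bi_inf_proj bA; have pQ := bi_inf_proj bQ.
have pA' := bi_inf_proj bA'; have pQ' := bi_inf_proj bQ'.
have lQ' := addline_le pA' A'v.
have l : le_proj A Q by apply: phi_le_inv => //; [exact: (proj1 bA) | rewrite eA eQ].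
have [W [W' [uW WK WK' h]]] :=
  same_angle_sym (phi_angle (proj2 bA) (proj1 bQ)).
have e u : Q u - A u = line (W v) u.
  rewrite -(compress_compl u pA pQ l) h phi_compl // eA eQ compress_compl //.
  by rewrite /padd addrC addKr unitary_line.
have Ax : A (W v) = 0.
  have := congr1 A (e (W v)); rewrite line_id (projD pA) (projN pA) (projK pA).
  by rewrite (le_projC pA pQ l) subrr.
exists (W v) => u [_ hu]; have [_] := hu A bA Ax.
have -> : padd A (line (W v)) = Q.
  by apply: funext => t; rewrite /padd -e addrC subrK.
rewrite eA eQ => /(congr1 (fun f t => f t - A' t)) h'.
by apply: funext => t; move/(congr1 (@^~ t)): h'; rewrite /padd /= ![A' t + _]addrC !addrK.
Qed.

(* Every line in the range of [M] is a difference of two members of [bi_inf]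
   below [M], hence invariant under [Q]; so [Q] is scalar on the range of [M]. *)
Lemma le_proj_of_comm M Q : proj_inf ip M -> is_projection ip Q ->
  ~ proj_inf ip (compl Q) ->
  (forall A, bi_inf A -> le_proj A M -> forall x, Q (A x) = A (Q x)) ->
  le_proj M Q.
Proof.
move=> hM pQ nQ hA; have [pM _] := hM.
have eig x : M x = x -> Q x = 0 \/ Q x = x.
  move=> Mx.
  have [C [D [[hC hD] CM _ o /(_ x)]]] := orthogonal_subprojections [:: x] hM hM.
  rewrite mem_head => /(_ isT)[Cx _].
  have bC := bi_inf_orth hC hD o.
  have := hA _ (bi_inf_addline bC Cx) _ x; rewrite /padd => h.
  have : Q x = line x (Q x).
    have := h _; rewrite Cx line_id add0r -(hA C) // Cx (proj0 pQ) add0r.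
    apply=> u; rewrite (projD pM) CM; congr (_ + _).
    by rewrite /line (projZ pM) Mx.
  rewrite /line; move: (_ / _) => c Qx.
  have := projK pQ x; rewrite {1}Qx (projZ pQ) => /eqP.
  rewrite -subr_eq0 -{2}[Q x]scale1r -scalerBl scaler_eq0 subr_eq0.
  by case/orP => /eqP h'; [right; rewrite Qx h' scale1r | left].
(* Otherwise [Q] kills some nonzero [x] in the range of [M]. Testing [x + y] then shows that it
   kills the whole range, so [compl Q] has infinite rank. *)
have [//|/existsNP[x0 nx]] := pselect (le_proj M Q).
have Mx := projK pM x0.
set x := M x0 in nx Mx.
have x0' : x <> 0 by move=> e; apply: nx; rewrite e (proj0 pQ).
have Qx : Q x = 0 by have [|//] := eig x Mx.
exfalso; apply: nQ; apply: proj_inf_le hM (proj_compl pQ) _ => u; rewrite /compl.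
have My := projK pM u; set y := M u in My *.
have [->|Qy] := eig y My; first by rewrite subr0.
have [||] := eig (x + y); first by rewrite (projD pM) Mx My.
  by rewrite (projD pQ) Qx Qy add0r => y0; rewrite y0 subrr.
by rewrite (projD pQ) Qx Qy => /addIr/esym/x0'.
Qed.

(** * Conjugation by [U] and the final comparison *)

Section Conjugate.
Variables (s : {rmorphism K -> K}) (U U' : V -> V).
Hypothesis U_ip : forall x y, ip (U x) (U y) = s (ip x y).
Hypothesis UK : cancel U U'.
Hypothesis UK' : cancel U' U.

Lemma proj_conjugate P : is_projection ip P ->
  is_projection ip (fun x => U (P (U' x))).
Proof.
move=> pP; apply: mk_projection => [x y|x]; last by rewrite UK (projK pP).
by rewrite -{1}(UK' y) -{2}(UK' x) !U_ip (projC pP).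
Qed.

Lemma proj_inf_conjugate P : proj_inf ip P ->
  proj_inf ip (fun x => U (P (U' x))).
Proof.
move=> hP; apply: (@proj_inf_isometry s U P) => //.
- exact: rmorph0.
- by move=> a /eqP; rewrite fmorph_eq0 => /eqP.
- exact/proj_conjugate/(proj1 hP).
- by move=> x e; rewrite UK e.
Qed.

End Conjugate.

(** Here [QPQ = Q] is idempotent, hence so is the equivalent operator [Q'P'Q']. *)
Lemma compress_le_comm P Q P' Q' : is_projection ip P -> is_projection ip Q ->
  is_projection ip P' -> is_projection ip Q' -> same_angle ip P Q P' Q' ->
  le_proj Q P -> forall x, P' (Q' x) = Q' (P' x).
Proof.
move=> pP pQ pP' pQ' [W [W' [uW WK WK' h]]] l.
by apply: compress_idem_comm => // x; rewrite !h WK !l !(projK pQ).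
Qed.

Lemma phi_conjugation : exists U U' : V -> V,
  [/\ unitary ip U \/ antiunitary cj ip U, cancel U U', cancel U' U &
      forall P, proj_inf ip P -> forall x, phi P x = U (P (U' x))].
Proof.
have /choice[T TP] := exists_vector_image.
have [e [_ e0 _]] : exists z, [/\ True, z <> 0 & forall y, y \in [::] -> ip z y = 0].
  exact: (infinite_dimensional_perp [::] (S := fun=> True)).
have Tsurj v : exists x c, v = c *: T x.
  have [x hx] := vector_image_surj v; exists x.
  exists (ip v (T x) / ip (T x) (T x)).
  by rewrite -[LHS]line_id -(hx _ (TP x)).
have [U [U_unit U_T]] :=
  wigner (fun x y => vector_image_norm (TP x) (TP y)) Tsurj e0.
have [s [sK [U_lin U_surj U_ip]]] : exists s : {rmorphism K -> K},
    involutive s /\ isometric_onto ip s U.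
  by case: U_unit => h; [exists idfun | exists cj].
have U_inj x y : U x = U y -> x = y.
  move=> h; apply: ip_ext => z; apply: (can_inj sK).
  by rewrite -!U_ip h.
have /choice[U' UK'] := U_surj.
have UK : cancel U U' by move=> x; apply: U_inj; rewrite UK'.
have U'_ip x y : ip (U' x) (U' y) = s (ip x y).
  by rewrite -[LHS]sK -U_ip !UK'.
have UD x y : U (x + y) = U x + U y.
  by rewrite -{1}[x]scale1r U_lin rmorph1 scale1r.
have U0 : U 0 = 0 by apply: ip_eq0; rewrite U_ip ip0l rmorph0.
have phiU P x : bi_inf P -> phi P (U x) = U (P x).
  move=> bP; have pP := bi_inf_proj bP; have pP' := bi_inf_proj (phi_bi bP).
  have fixU y : P y = y -> phi P (U y) = U y.
    move=> Py; have [c ->] := U_T y; rewrite (projZ pP').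
    by rewrite (vector_image_fix (TP y) bP Py).
  have perpU y : P y = 0 -> phi P (U y) = 0.
    move=> Py; have [c ->] := U_T y; rewrite (projZ pP').
    by rewrite (vector_image_perp (TP y) bP Py) scaler0.
  rewrite -{1}[x](subrK (P x)) UD (projD pP') perpU ?add0r ?fixU ?(projK pP) //.
  by rewrite (projD pP) (projN pP) (projK pP) subrr.
exists U, U'; split => // P hP x.
have [bP|nP] := pselect (bi_inf P); first by rewrite -phiU // UK'.
have [pP _] := hP; have hP' := phi_inf hP; have [pP' _] := hP'.
have nP' : ~ bi_inf (phi P) by move/(phi_bi_inf hP).
(* [A] below [U P U'] is [phi A0] with [A0] below [P], so the angle of [P] and [A0] makes [phi P]
   commute with [A]. *)
have l1 : le_proj (fun x => U (P (U' x))) (phi P).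
  apply: le_proj_of_comm => //; first exact: (proj_inf_conjugate U_ip UK UK').
    by move=> h; apply: nP'.
  move=> A bA lA; have [A0 bA0 e0A] := phi_bi_surj bA.
  have pA0 := bi_inf_proj bA0; have pA := bi_inf_proj bA.
  have h := phi_angle hP (proj1 bA0); rewrite e0A in h.
  apply: (compress_le_comm pP pA0 pP' pA h) => y.
  apply: U_inj; have := lA (U (A0 y)).
  by rewrite -e0A phiU // (projK pA0) UK.
(* The same argument with [U'] in place of [U] and the angle read backwards. *)
have l2 : le_proj (fun x => U' (phi P (U x))) P.
  apply: le_proj_of_comm => //; first exact: (proj_inf_conjugate U'_ip UK' UK).
    by move=> h; apply: nP.
  move=> A bA lA.
  have pA := bi_inf_proj bA; have pA' := bi_inf_proj (phi_bi bA).
  have h := same_angle_sym (phi_angle hP (proj1 bA)).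
  apply: (compress_le_comm pP' pA' pP pA h) => y.
  rewrite -[y]UK' phiU //; have := congr1 U (lA (U' y)).
  by rewrite UK'.
have l3 : le_proj (phi P) (fun x => U (P (U' x))).
  by move=> y; have := congr1 U (l2 (U' y)); rewrite !UK'.
have E : phi P = (fun x => U (P (U' x))).
  by apply: le_proj_anti => //; exact: (proj_conjugate U_ip UK UK').
by rewrite E.
Qed.

End Phi.

End InnerProduct.

(** * The real and complex scalars *)

Section Instances.
Variable R : realType.

Lemma real_inf_exists (S : R -> Prop) :
  (exists a, S a) -> (forall a, S a -> 0 <= a) ->
  exists g, (forall a, S a -> g <= a) /\
    forall e : R, 0 < e -> exists2 a, S a & a < g + e.
Proof.
move=> S0 Sge; exists (inf S).
have lb : has_lbound S by exists 0.
split=> [a Sa|e e0]; first exact: ge_inf.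
exact: inf_adherent.
Qed.

Lemma real_invn_small (e : R) : 0 < e -> exists n, n.+1%:R^-1 < e.
Proof.
move=> e0; exists (Num.bound e^-1).
rewrite invf_plt ?posrE ?ltr0n //.
have h : e^-1 < (Num.bound e^-1)%:R by apply: archi_boundP; rewrite invr_ge0 ltW.
by apply: lt_trans h _; rewrite ltr_nat.
Qed.

(** Nonnegative elements of [R[i]] are real, which reduces infima and small inverses to the real
    case. *)
Lemma complex_ge0 (a : R[i]) : 0 <= a -> a = (complex.Re a)%:C%C.
Proof. by case: a => a b; rewrite lecE /= => /andP[/eqP -> _]. Qed.

Lemma complex_inf_exists (S : R[i] -> Prop) :
  (exists a, S a) -> (forall a, S a -> 0 <= a) ->
  exists g, (forall a, S a -> g <= a) /\
    forall e : R[i], 0 < e -> exists2 a, S a & a < g + e.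
Proof.
move=> [a0 Sa0] Sge.
have [||g [gle ginf]] := real_inf_exists (S := fun r => S r%:C%C).
- by exists (complex.Re a0); rewrite -complex_ge0 ?Sge.
- by move=> a /Sge; rewrite lecR.
exists g%:C%C; split=> [a Sa|e e0].
  have ea := complex_ge0 (Sge a Sa).
  by rewrite ea lecR; apply: gle; rewrite -ea.
move: (e0); rewrite (complex_ge0 (ltW e0)) ltcR => /ginf[a Sa ha].
by exists a%:C%C => //; rewrite -rmorphD ltcR.
Qed.

Lemma complex_invn_small (e : R[i]) : 0 < e -> exists n, n.+1%:R^-1 < e.
Proof.
move=> e0; move: (e0); rewrite (complex_ge0 (ltW e0)) ltcR.
move=> /real_invn_small[n hn]; exists n.
by rewrite -(rmorph_nat (real_complex R)) -fmorphV ltcR.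
Qed.

End Instances.

Theorem theorem4 :
  (forall (R : realType) (V : lmodType R) (ip : V -> V -> R),
      theorem4_body (fun a : R => a) ip) /\
  (forall (R : realType) (V : lmodType R[i]) (ip : V -> V -> R[i]),
      theorem4_body (@conjc R) ip).
Proof.
split=> R V ip [ipP ip_cpl] V_inf phi phi_inf phi_surj phi_angle.
  apply: (@phi_conjugation R idfun) => //.
  - by move=> z; rewrite real_normK ?num_real.
  - exact: real_inf_exists.
  - exact: real_invn_small.
apply: (@phi_conjugation R[i] (@conjc R)) => //.
- exact: conjcK.
- by move=> z; rewrite sqr_normc.
- exact: complex_inf_exists.
- exact: complex_invn_small.
Qed.
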